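(* Let $p,\delta\in(0,1)$ and $C>0$ be fixed constants, and let $\{G_n\}_{n\in\mathbb{N}}$ be a sequence of graphs, $G_n$ having vertex set $[n]$, such that $$\max_{v\in[n]}\bigl||N_v|-np\bigr|<Cn^{\delta},\qquad \max_{v_1,v_2}\bigl||N_{v_1}\cap N_{v_2}|-np^2\bigr|<Cn^{\delta},$$ $$\max_{v_1,v_2,v_3}\bigl||N_{v_1}\cap N_{v_2}\cap N_{v_3}|-np^3\bigr|<Cn^{\delta},\qquad \max_{v_1,v_2,v_3,v_4}\bigl||N_{v_1}\cap N_{v_2}\cap N_{v_3}\cap N_{v_4}|-np^4\bigr|<Cn^{\delta},$$ where the last three maxima are over pairwise distinct vertices of $[n]$. Then there exists a positive constant $C_5'$, depending on $p$, such that $$\max_{s\le \left((1-\delta)\wedge\frac23\right)\frac{\log n}{\log\gamma_p}-C_5'\log\log n}\ \max_{H_s\in\mathcal{G}(s)}\left|\frac{n_{G_n}(H_s)}{\frac{(n)_s}{|\mathrm{Aut}(H_s)|}\left(\frac{p}{1-p}\right)^{|E(H_s)|}(1-p)^{\binom{s}{2}}}-1\right|\longrightarrow 0$$ as $n\to\infty$.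
   Context: $[n]=\{1,\dots,n\}$; graphs are simple and undirected. For a vertex $v$ of $G_n$, $N_v=\{u\in[n]:u\sim v\}$ is its set of neighbours in $G_n$. $\mathcal{G}(s)$ is the collection of all graphs with vertex set $[s]$ ($s$ a positive integer). For a graph $H$, $n_{G_n}(H)$ is the number of induced isomorphic copies of $H$ in $G_n$ (i.e. the number of vertex subsets of $[n]$ whose induced subgraph in $G_n$ is isomorphic to $H$), $E(H)$ is the edge set of $H$, and $\mathrm{Aut}(H)$ its automorphism group. $\gamma_p=\max\{p^{-1},(1-p)^{-1}\}$, $(n)_s=n(n-1)\cdots(n-s+1)$, $a\wedge b=\min\{a,b\}$, and $\log$ is the natural logarithm. *)

(* Defs.v *)
From HB Require Import structures.
From mathcomp Require Import all_boot all_order all_fingroup all_algebra.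
From mathcomp Require Import all_classical all_reals all_analysis.
Set Implicit Arguments.
Unset Strict Implicit.
Unset Printing Implicit Defensive.
Import Order.TTheory GRing.Theory Num.Theory.
Import numFieldNormedType.Exports.
Local Open Scope ring_scope.

(* A simple undirected graph on T is given by its edge set, a set of unordered
   pairs of distinct vertices. *)
Definition sgraph (T : finType) :=
  {E : {set {set T}} | [forall e in E, #|e| == 2]}.
HB.instance Definition _ (T : finType) := Finite.on (sgraph T).

Definition edges (T : finType) (G : sgraph T) : {set {set T}} := val G.

(* [set x; x] is a singleton, so adj is irreflexive. *)
Definition adj (T : finType) (G : sgraph T) : rel T :=
  fun x y => ([set x; y] : {set T}) \in edges G.

Definition nbr (T : finType) (G : sgraph T) (v : T) : {set T} :=
  [set u | adj G u v].

Definition induced_embedding (S T : finType) (H : sgraph S) (G : sgraph T)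
    (f : {ffun S -> T}) : bool :=
  injectiveb f && [forall x, forall y, adj G (f x) (f y) == adj H x y].

(* A carries an induced copy of H exactly when it is the image of an
   isomorphism from H onto G[A]. *)
Definition induced_copies (S T : finType) (H : sgraph S) (G : sgraph T)
    : {set {set T}} :=
  [set A | [exists f : {ffun S -> T},
              induced_embedding H G f && (f @: [set: S] == A)]].

Definition graph_aut (S : finType) (H : sgraph S) : {set {perm S}} :=
  [set a : {perm S} | [forall x, forall y, adj H (a x) (a y) == adj H x y]].

Definition gamma (R : realType) (p : R) : R := Num.max p^-1 (1 - p)^-1.

Definition expected_copies (R : realType) (p : R) (n s : nat)
    (H : sgraph 'I_s) : R :=
  (n ^_ s)%:R / #|graph_aut H|%:R * (p / (1 - p)) ^+ #|edges H|
  * (1 - p) ^+ 'C(s, 2).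

Definition copies_deviation (R : realType) (p : R) (n s : nat)
    (G : sgraph 'I_n) (H : sgraph 'I_s) : R :=
  `| #|induced_copies H G|%:R / expected_copies p n H - 1 |.

(* The maximum over all integers 1 <= s <= b and all graphs H on s vertices;
   for s >= 1, s <= truncn b iff s%:R <= b.  The quantities are nonnegative, so
   0 is a neutral default; it is the value when no s >= 1 satisfies s <= b. *)
Definition max_copies_deviation (R : realType) (p : R) (n : nat)
    (G : sgraph 'I_n) (b : R) : R :=
  \big[Num.max/0]_(1 <= s < (Num.truncn b).+1)
    \big[Num.max/0]_(H : sgraph 'I_s) copies_deviation p G H.

(* Main.v *)
Require Import Defs.
From mathcomp Require Import all_boot all_order all_fingroup all_algebra.
From mathcomp Require Import all_classical all_reals all_analysis.
From mathcomp Require Import ring lra zify.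
Import Order.TTheory GRing.Theory Num.Theory.
Import numFieldNormedType.Exports.
Local Open Scope ring_scope.

(** Embed the vertices of H one after the other.  Once t of them are placed,
    the vertices of G that are still possible images of a later vertex of H
    form a candidate set, and the embedding splits this set further with each
    new vertex x.  If each split has nearly the expected ratio p or 1 - p, then
    the last vertex has about n * p ^ i * (1 - p) ^ j possible images, as in a
    random graph.

    Few vertices x split a candidate set A badly.  With the centred adjacency
    a = adj - p, the fourth moment over x of the sum of a over A expands into
    sums over x of products of four centred entries.  Control of the common
    neighbourhoods of up to four vertices makes such a sum O(n ^ delta), unless
    the four indices pair up, which happens for at most 3 |A| ^ 2 quadruples
    ([fourth_moment]).  Hence at most about n ^ delta + n / |A| ^ 2 vertices
    are bad for A ([splits_badly_card]).  As |A| is at least about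
    n * gamma ^ - s, this is much smaller than n * gamma ^ - s itself exactly
    when gamma ^ s is much smaller than n ^ (1 - delta) and than n ^ (2 / 3):
    this is the origin of the bound (1 - delta) /\ 2/3.

    It remains to see that embeddings which make a bad choice are rare, although
    nothing is known on the candidate sets after a bad choice.  The observation
    is that whether the image of vertex t is bad depends on the images of the
    earlier vertices only.  Forget therefore all edges between t and the later
    vertices: an embedding with a bad choice at t is an embedding of H - t
    together with one of the few bad vertices ([card_embeddings_in]).
    Embeddings of H - t are counted by induction on the number of vertices, and
    the expected number of embeddings of H is at least n * gamma ^ - s times
    larger.  So the bad embeddings are negligible, both before the last vertex
    is added (lower bound) and after it (upper bound); [embeddings_estimate]
    carries out this induction with explicit errors.

    Finally the number of induced copies is the number of embeddings divided by
    |Aut H|, and with L = log n, tolerance L ^ - 3 for each split and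
    C5 = 15 / log gamma, the total error is O(1 / L). *)

(** * Fourth moments of the centred adjacency matrix *)

Lemma adjC (T : finType) (G : sgraph T) (x y : T) : adj G x y = adj G y x.
Proof. by rewrite /adj finset.setUC. Qed.

Lemma adj_irr (T : finType) (G : sgraph T) (x : T) : adj G x x = false.
Proof.
apply/negbTE/negP; rewrite /adj finset.setUid => xE.
by have /forall_inP/(_ _ xE) := valP G; rewrite cards1.
Qed.

Section FourthMoment.
Context {R : realFieldType} {T : finType}.
Variables (G : sgraph T) (p D : R).
Hypothesis p01 : 0 < p < 1.
Local Notation n := (@GRing.natmul R 1 #|T|).

Definition centred_adj (x v : T) : R := (adj G x v)%:R - p.
Local Notation a := centred_adj.

Definition pseudorandom4 : Prop := [/\
  forall v, `| #|nbr G v|%:R - n * p | <= D,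
  forall v1 v2, uniq [:: v1; v2] ->
    `| #|nbr G v1 :&: nbr G v2|%:R - n * p ^+ 2 | <= D,
  forall v1 v2 v3, uniq [:: v1; v2; v3] ->
    `| #|nbr G v1 :&: nbr G v2 :&: nbr G v3|%:R - n * p ^+ 3 | <= D &
  forall v1 v2 v3 v4, uniq [:: v1; v2; v3; v4] ->
    `| #|nbr G v1 :&: nbr G v2 :&: nbr G v3 :&: nbr G v4|%:R
       - n * p ^+ 4 | <= D].

Hypothesis Gp : pseudorandom4.

Lemma card_sum_mem (A : {set T}) : #|A|%:R = \sum_x (x \in A)%:R :> R.
Proof.
rewrite -natr_sum -sum1_card big_mkcond.
by congr _%:R; apply: eq_bigr => x _; case: (x \in A).
Qed.

Lemma sum_sub_const (c : R) (f : T -> R) :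
  \sum_x (f x - c) = \sum_x f x - n * c.
Proof. by rewrite sumrB sumr_const mulr_natl. Qed.

Let i (v x : T) : R := (adj G x v)%:R.

Lemma codegree_error_ge0 (v : T) : 0 <= D.
Proof. by case: Gp => /(_ v) h _ _ _; apply: le_trans h. Qed.

Lemma sum_adj1 v : `|\sum_x (i v x - p)| <= D.
Proof.
case: Gp => /(_ v) h _ _ _; rewrite sum_sub_const.
suff <- : #|nbr G v|%:R = \sum_x i v x by [].
by rewrite card_sum_mem; apply: eq_bigr => x _; rewrite inE.
Qed.

Lemma sum_adj2 v1 v2 : uniq [:: v1; v2] -> `|\sum_x (i v1 x * i v2 x - p ^+ 2)| <= D.
Proof.
case: Gp => _ h _ _ /h; rewrite sum_sub_const card_sum_mem.
by congr (`|_ - _| <= _); apply: eq_bigr => x _; rewrite !inE -!mulnb !natrM.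
Qed.

Lemma sum_adj3 v1 v2 v3 : uniq [:: v1; v2; v3] ->
  `|\sum_x (i v1 x * i v2 x * i v3 x - p ^+ 3)| <= D.
Proof.
case: Gp => _ _ h _ /h; rewrite sum_sub_const card_sum_mem.
by congr (`|_ - _| <= _); apply: eq_bigr => x _; rewrite !inE -!mulnb !natrM.
Qed.

Lemma sum_adj4 v1 v2 v3 v4 : uniq [:: v1; v2; v3; v4] ->
  `|\sum_x (i v1 x * i v2 x * i v3 x * i v4 x - p ^+ 4)| <= D.
Proof.
case: Gp => _ _ _ h /h; rewrite sum_sub_const card_sum_mem.
by congr (`|_ - _| <= _); apply: eq_bigr => x _; rewrite !inE -!mulnb !natrM.
Qed.

Lemma norm_scale_le (k : nat) (t : R) : `|t| <= D -> - D <= p ^+ k * t <= D.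
Proof.
move=> tD; rewrite -ler_norml normrM.
have [p0 p1] := andP p01.
have pk0 : 0 <= p ^+ k by apply: exprn_ge0; lra.
have pk1 : p ^+ k <= 1 by apply: exprn_ile1; lra.
rewrite (ger0_norm pk0) (le_trans _ tD) // ler_piMl //.
Qed.

(** Expanding the product of the factors adj - p gives products of fewer
    adjacencies; subtracting from each its main term leaves only errors, since
    the main terms add up to n * (p - p) ^ k = 0.  There are at most 2 ^ k
    errors, each bounded by the codegree error. *)
Lemma sum_centred2 v1 v2 : v1 != v2 -> `|\sum_x a x v1 * a x v2| <= 3 * D.
Proof.
move=> n12.
have -> : \sum_x a x v1 * a x v2 = \sum_x (i v1 x * i v2 x - p ^+ 2)
   - p ^+ 1 * \sum_x (i v1 x - p) - p ^+ 1 * \sum_x (i v2 x - p).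
  rewrite !mulr_sumr -!sumrB; apply: eq_bigr => x _.
  by rewrite /a /i; ring.
have u : uniq [:: v1; v2] by rewrite /= inE n12.
have := norm_scale_le 1 _ (sum_adj1 v1); have := norm_scale_le 1 _ (sum_adj1 v2).
by have := sum_adj2 _ _ u; rewrite !ler_norml; lra.
Qed.

Lemma sum_centred3 v1 v2 v3 : uniq [:: v1; v2; v3] ->
  `|\sum_x a x v1 * a x v2 * a x v3| <= 8 * D.
Proof.
move=> u.
have -> : \sum_x a x v1 * a x v2 * a x v3 =
   \sum_x (i v1 x * i v2 x * i v3 x - p ^+ 3)
   - p ^+ 1 * \sum_x (i v1 x * i v2 x - p ^+ 2)
   - p ^+ 1 * \sum_x (i v1 x * i v3 x - p ^+ 2)
   - p ^+ 1 * \sum_x (i v2 x * i v3 x - p ^+ 2)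
   + p ^+ 2 * \sum_x (i v1 x - p) + p ^+ 2 * \sum_x (i v2 x - p)
   + p ^+ 2 * \sum_x (i v3 x - p).
  rewrite !mulr_sumr -!(sumrB, big_split); apply: eq_bigr => x _.
  by rewrite /a /i /=; ring.
have [u12 u13 u23] : [/\ uniq [:: v1; v2], uniq [:: v1; v3] & uniq [:: v2; v3]].
  by move: u; rewrite /= !inE !negb_or; case/and3P => /andP[-> ->] -> _.
have := sum_adj3 _ _ _ u.
have := norm_scale_le 2 _ (sum_adj1 v1); have := norm_scale_le 2 _ (sum_adj1 v2).
have := norm_scale_le 2 _ (sum_adj1 v3); have := norm_scale_le 1 _ (sum_adj2 _ _ u12).
have := norm_scale_le 1 _ (sum_adj2 _ _ u13).
have := norm_scale_le 1 _ (sum_adj2 _ _ u23).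
by rewrite !ler_norml; lra.
Qed.

Lemma sum_centred4 v1 v2 v3 v4 : uniq [:: v1; v2; v3; v4] ->
  `|\sum_x a x v1 * a x v2 * a x v3 * a x v4| <= 16 * D.
Proof.
move=> u.
have -> : \sum_x a x v1 * a x v2 * a x v3 * a x v4 =
   \sum_x (i v1 x * i v2 x * i v3 x * i v4 x - p ^+ 4)
   - p ^+ 1 * \sum_x (i v1 x * i v2 x * i v3 x - p ^+ 3)
   - p ^+ 1 * \sum_x (i v1 x * i v2 x * i v4 x - p ^+ 3)
   - p ^+ 1 * \sum_x (i v1 x * i v3 x * i v4 x - p ^+ 3)
   - p ^+ 1 * \sum_x (i v2 x * i v3 x * i v4 x - p ^+ 3)
   + p ^+ 2 * \sum_x (i v1 x * i v2 x - p ^+ 2)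
   + p ^+ 2 * \sum_x (i v1 x * i v3 x - p ^+ 2)
   + p ^+ 2 * \sum_x (i v1 x * i v4 x - p ^+ 2)
   + p ^+ 2 * \sum_x (i v2 x * i v3 x - p ^+ 2)
   + p ^+ 2 * \sum_x (i v2 x * i v4 x - p ^+ 2)
   + p ^+ 2 * \sum_x (i v3 x * i v4 x - p ^+ 2)
   - p ^+ 3 * \sum_x (i v1 x - p) - p ^+ 3 * \sum_x (i v2 x - p)
   - p ^+ 3 * \sum_x (i v3 x - p) - p ^+ 3 * \sum_x (i v4 x - p).
  rewrite !mulr_sumr -!(sumrB, big_split); apply: eq_bigr => x _.
  by rewrite /a /i /=; ring.
have := u; rewrite /= !inE !negb_or => /and4P[/and3P[n12 n13 n14]].
move=> /andP[n23 n24] n34 _.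
have u3 (w1 w2 w3 : T) : w1 != w2 -> w1 != w3 -> w2 != w3 -> uniq [:: w1; w2; w3].
  by move=> h1 h2 h3; rewrite /= !inE negb_or h1 h2 h3.
have u2 (w1 w2 : T) : w1 != w2 -> uniq [:: w1; w2] by move=> h; rewrite /= inE h.
have := sum_adj4 _ _ _ _ u.
have := norm_scale_le 1 _ (sum_adj3 _ _ _ (u3 _ _ _ n12 n13 n23)).
have := norm_scale_le 1 _ (sum_adj3 _ _ _ (u3 _ _ _ n12 n14 n24)).
have := norm_scale_le 1 _ (sum_adj3 _ _ _ (u3 _ _ _ n13 n14 n34)).
have := norm_scale_le 1 _ (sum_adj3 _ _ _ (u3 _ _ _ n23 n24 n34)).
have := norm_scale_le 2 _ (sum_adj2 _ _ (u2 _ _ n12)).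
have := norm_scale_le 2 _ (sum_adj2 _ _ (u2 _ _ n13)).
have := norm_scale_le 2 _ (sum_adj2 _ _ (u2 _ _ n14)).
have := norm_scale_le 2 _ (sum_adj2 _ _ (u2 _ _ n23)).
have := norm_scale_le 2 _ (sum_adj2 _ _ (u2 _ _ n24)).
have := norm_scale_le 2 _ (sum_adj2 _ _ (u2 _ _ n34)).
have := norm_scale_le 3 _ (sum_adj1 v1); have := norm_scale_le 3 _ (sum_adj1 v2).
have := norm_scale_le 3 _ (sum_adj1 v3); have := norm_scale_le 3 _ (sum_adj1 v4).
have := codegree_error_ge0 v1.
by rewrite !ler_norml; lra.
Qed.

(** A centred entry takes two values only, so its powers are affine in it: this
    is what reduces a product with repeated indices to products of distinct
    ones. *)
Lemma centred_sqr x v : a x v * a x v = p * (1 - p) + (1 - 2 * p) * a x v.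
Proof. by rewrite /a; case: adj => /=; ring. Qed.

Lemma norm_centred_le1 x v : `|a x v| <= 1.
Proof. by have := p01; rewrite ler_norml /a; case: adj => /=; lra. Qed.

Lemma norm_lincomb (c d : R) (k l : nat) (t u : R) : `|c| <= 1 -> `|d| <= 1 ->
  `|t| <= k%:R * D -> `|u| <= l%:R * D -> `|c * t + d * u| <= (k + l)%:R * D.
Proof.
move=> c1 d1 tD uD; rewrite natrD mulrDl (le_trans (ler_normD _ _))//.
by rewrite !normrM lerD//; apply: (le_trans (ler_piMl _ _)).
Qed.

(** Repetitions among the last three indices are removed by [centred_sqr], and
    the isolated factor survives in all resulting terms, so that no term of
    order n appears. *)
Lemma sum_centred_isolated v w1 w2 w3 : v != w1 -> v != w2 -> v != w3 ->
  `|\sum_x a x v * a x w1 * a x w2 * a x w3| <= 16 * D.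
Proof.
have [p0 p1] := andP p01.
have D0 := codegree_error_ge0 v.
have c1 : `|p * (1 - p)| <= 1 by rewrite ler_norml; nra.
have c2 : `|1 - 2 * p| <= 1 by rewrite ler_norml; lra.
have pair w w' : v != w -> v != w' -> w != w' ->
    `|\sum_x a x v * a x w' * (a x w * a x w)| <= 16 * D.
  move=> vw vw' ww'.
  have -> : \sum_x a x v * a x w' * (a x w * a x w) =
     p * (1 - p) * (\sum_x a x v * a x w') +
     (1 - 2 * p) * (\sum_x a x v * a x w' * a x w).
    rewrite !mulr_sumr -!big_split /=; apply: eq_bigr => x _.
    by rewrite centred_sqr; ring.
  have u : uniq [:: v; w'; w] by rewrite /= !inE negb_or vw vw' eq_sym ww'.
  have := norm_lincomb _ _ 3 8 _ _ c1 c2 (sum_centred2 _ _ vw') (sum_centred3 _ _ _ u).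
  by move/le_trans; apply; lra.
move=> n1 n2 n3.
have [e12|n12] := eqVneq w1 w2.
  have [e13|n13] := eqVneq w1 w3.
    rewrite -e12 -e13.
    have -> : \sum_x a x v * a x w1 * a x w1 * a x w1 =
       (1 - 2 * p) * (p * (1 - p)) * (\sum_x a x v) +
       (1 - 3 * p + 3 * p ^+ 2) * (\sum_x a x v * a x w1).
      rewrite !mulr_sumr -!big_split /=; apply: eq_bigr => x _.
      rewrite -2!mulrA centred_sqr mulrDr.
      rewrite [a x w1 * (_ * a x w1)]mulrCA centred_sqr; ring.
    have c3 : `|(1 - 2 * p) * (p * (1 - p))| <= 1.
      by rewrite normrM mulr_ile1.
    have c4 : `|1 - 3 * p + 3 * p ^+ 2| <= 1 by rewrite ler_norml; nra.
    have s1 : `|\sum_x a x v| <= 1 * D by rewrite mul1r; exact: sum_adj1.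
    have := norm_lincomb _ _ 1 3 _ _ c3 c4 s1 (sum_centred2 _ _ n1).
    by move/le_trans; apply; lra.
  rewrite -e12 (eq_bigr (fun x => a x v * a x w3 * (a x w1 * a x w1))).
    exact: pair.
  by move=> x _; ring.
have [e13|n13] := eqVneq w1 w3.
  rewrite -e13 (eq_bigr (fun x => a x v * a x w2 * (a x w1 * a x w1))).
    exact: pair.
  by move=> x _; ring.
have [e23|n23] := eqVneq w2 w3.
  rewrite -e23 (eq_bigr (fun x => a x v * a x w1 * (a x w2 * a x w2))).
    by apply: pair => //; rewrite eq_sym.
  by move=> x _; ring.
by apply: sum_centred4; rewrite /= !inE !negb_or n1 n2 n3 n12 n13 n23.
Qed.

(** If no index is isolated then the four indices pair up, and the sum is at
    most n because centred entries have absolute value at most 1. *)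
Lemma sum_centred_le v1 v2 v3 v4 :
  `|\sum_x a x v1 * a x v2 * a x v3 * a x v4| <= 16 * D
    + n * ((v1 == v2)%:R * (v3 == v4)%:R + (v1 == v3)%:R * (v2 == v4)%:R
           + (v1 == v4)%:R * (v2 == v3)%:R).
Proof.
have D0 := codegree_error_ge0 v1.
have n0 : 0 <= n by [].
pose I := [|| (v1 == v2) && (v3 == v4), (v1 == v3) && (v2 == v4)
           | (v1 == v4) && (v2 == v3)].
apply: (@le_trans _ _ (16 * D + n * I%:R)); last first.
  (* The three pairings overlap when all indices agree, hence an inequality. *)
  rewrite lerD2l ler_wpM2l// -!natrM -!natrD ler_nat /I.
  by case: (v1 == v2); case: (v1 == v3); case: (v1 == v4); case: (v2 == v3);
    case: (v2 == v4); case: (v3 == v4).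
case: (boolP I) => [_|].
  rewrite mulr1 (@le_trans _ _ n)//; last by lra.
  apply: le_trans (ler_norm_sum _ _ _) _.
  apply: (@le_trans _ _ (\sum_(x : T) 1)); last by rewrite sumr_const.
  apply: ler_sum => x _; rewrite !normrM.
  have le1 := norm_centred_le1 x.
  by rewrite mulr_ile1 ?mulr_ge0// mulr_ile1 ?mulr_ge0// mulr_ile1.
rewrite /I mulr0 addr0 => nI.
have iso : [|| [&& v1 != v2, v1 != v3 & v1 != v4],
    [&& v2 != v1, v2 != v3 & v2 != v4], [&& v3 != v1, v3 != v2 & v3 != v4]
    | [&& v4 != v1, v4 != v2 & v4 != v3]].
  apply: contraR nI; rewrite !negb_or !negb_and !negbK.
  rewrite ![v2 == v1]eq_sym ![v3 == v1]eq_sym ![v3 == v2]eq_sym.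
  rewrite ![v4 == v1]eq_sym ![v4 == v2]eq_sym ![v4 == v3]eq_sym.
  by case: (v1 =P v2); case: (v1 =P v3); case: (v1 =P v4); case: (v2 =P v3);
    case: (v2 =P v4); case: (v3 =P v4) => //=; congruence.
case/or4P: iso => /and3P[h1 h2 h3].
- exact: sum_centred_isolated.
- rewrite (eq_bigr (fun x => a x v2 * a x v1 * a x v3 * a x v4)).
    exact: sum_centred_isolated.
  by move=> x _; ring.
- rewrite (eq_bigr (fun x => a x v3 * a x v1 * a x v2 * a x v4)).
    exact: sum_centred_isolated.
  by move=> x _; ring.
- rewrite (eq_bigr (fun x => a x v4 * a x v1 * a x v2 * a x v3)).
    exact: sum_centred_isolated.
  by move=> x _; ring.
Qed.

Lemma sum_indicator (A : {set T}) (v : T) : v \in A ->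
  \sum_(w in A) (w == v)%:R = 1 :> R.
Proof.
move=> vA; rewrite (bigD1 v)//= eqxx big1 ?addr0// => w /andP[_ /negbTE->//].
Qed.

Lemma fourth_moment (A : {set T}) :
  \sum_x (\sum_(w in A) a x w) ^+ 4
    <= 16 * D * #|A|%:R ^+ 4 + 3 * n * #|A|%:R ^+ 2.
Proof.
have -> : \sum_x (\sum_(w in A) a x w) ^+ 4 = \sum_(v1 in A) \sum_(v2 in A)
    \sum_(v3 in A) \sum_(v4 in A) \sum_x a x v1 * a x v2 * a x v3 * a x v4.
  transitivity (\sum_x \sum_(v1 in A) \sum_(v2 in A)
    \sum_(v3 in A) \sum_(v4 in A) a x v1 * a x v2 * a x v3 * a x v4).
    apply: eq_bigr => x _.
    rewrite !exprS expr0 mulr1 big_distrl /=; apply: eq_bigr => v1 _.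
    rewrite big_distrl big_distrr /=; apply: eq_bigr => v2 _.
    rewrite mulrA big_distrl big_distrr /=; apply: eq_bigr => v3 _.
    by rewrite mulrA big_distrr.
  rewrite exchange_big /=; apply: eq_bigr => v1 _.
  rewrite exchange_big /=; apply: eq_bigr => v2 _.
  rewrite exchange_big /=; apply: eq_bigr => v3 _.
  by rewrite exchange_big.
have sumK (c : R) : \sum_(v in A) c = #|A|%:R * c by rewrite sumr_const mulr_natl.
apply: (@le_trans _ _ (\sum_(v1 in A) \sum_(v2 in A) \sum_(v3 in A)
   \sum_(v4 in A) (16 * D
    + n * ((v1 == v2)%:R * (v3 == v4)%:R + (v1 == v3)%:R * (v2 == v4)%:R
           + (v1 == v4)%:R * (v2 == v3)%:R)))).
  do 4! (apply: ler_sum => ? ?).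
  exact: le_trans (ler_norm _) (sum_centred_le _ _ _ _).
rewrite le_eqVlt; apply/orP; left; apply/eqP.
transitivity (\sum_(v1 in A) \sum_(v2 in A) \sum_(v3 in A)
   (#|A|%:R * (16 * D)
    + n * ((v1 == v2)%:R + (v1 == v3)%:R + (v2 == v3)%:R))).
  apply: eq_bigr => v1 A1; apply: eq_bigr => v2 A2; apply: eq_bigr => v3 A3.
  rewrite big_split /= sumK; congr (_ + _).
  rewrite -mulr_sumr !big_split /= -!mulr_sumr -mulr_suml.
  under eq_bigr do rewrite eq_sym.
  rewrite sum_indicator//.
  under eq_bigr do rewrite eq_sym.
  rewrite sum_indicator//.
  under eq_bigr do rewrite eq_sym.
  by rewrite sum_indicator// !mulr1 mul1r.
transitivity (\sum_(v1 in A) \sum_(v2 in A)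
   (#|A|%:R * (#|A|%:R * (16 * D))
    + n * (#|A|%:R * (v1 == v2)%:R + 1 + 1))).
  apply: eq_bigr => v1 A1; apply: eq_bigr => v2 A2.
  rewrite big_split /= sumK; congr (_ + _).
  rewrite -mulr_sumr !big_split /= sumK.
  under eq_bigr do rewrite eq_sym.
  rewrite sum_indicator//.
  under eq_bigr do rewrite eq_sym.
  by rewrite sum_indicator.
transitivity (\sum_(v1 in A)
   (#|A|%:R * (#|A|%:R * (#|A|%:R * (16 * D)))
    + n * (#|A|%:R * 3))).
  apply: eq_bigr => v1 A1.
  rewrite big_split /= sumK; congr (_ + _).
  rewrite -mulr_sumr !big_split /= !sumK -mulr_sumr.
  under eq_bigr do rewrite eq_sym.
  by rewrite sum_indicator//; ring.
by rewrite sumK; ring.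
Qed.

Definition splits_badly (eta : R) (A : {set T}) : {set T} :=
  [set x | eta * #|A|%:R < `|\sum_(w in A) a x w|].

(** Markov's inequality for [fourth_moment]; a lower bound c on the size of A
    makes the bound uniform. *)
Lemma splits_badly_card (eta c : R) (A : {set T}) : 0 < eta -> 0 < c ->
  c <= #|A|%:R ->
  #|splits_badly eta A|%:R <= (16 * D + 3 * n / c ^+ 2) / eta ^+ 4.
Proof.
move=> eta0 c0 cA.
have A0 : 0 < #|A|%:R :> R by apply: lt_le_trans cA.
have [v _] : exists v, v \in A by apply/set0Pn; rewrite -card_gt0 -(ltr0n R).
have D0 := codegree_error_ge0 v.
rewrite ler_pdivlMr ?exprn_gt0//.
rewrite -(@ler_pM2r _ (#|A|%:R ^+ 4)) ?exprn_gt0//.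
rewrite -[leLHS]mulrA -exprMn.
apply: (@le_trans _ _ (\sum_x (\sum_(w in A) a x w) ^+ 4)).
  rewrite mulr_natl -sumr_const big_mkcond /=; apply: ler_sum => x _.
  rewrite inE; case: ifPn => [lt|_]; last exact: exprn_even_ge0.
  rewrite -[leRHS]ger0_norm ?exprn_even_ge0// normrX lerXn2r ?nnegrE//.
    by rewrite mulr_ge0 ?ltW.
  exact: ltW.
apply: le_trans (fourth_moment A) _.
rewrite [leRHS]mulrDl lerD2l -[leRHS]mulrA ler_wpM2l ?mulr_ge0//.
rewrite -[4%N]/(2 + 2)%N exprD mulrA ler_peMl ?exprn_ge0//.
by rewrite mulrC ler_pdivlMr ?exprn_gt0// mul1r lerXn2r// nnegrE ltW.
Qed.
End FourthMoment.

(** * Embeddings of a pattern and candidate sets *)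

(** Patterns are relations on natural numbers, so that deleting a vertex
    renumbers the others without changing the type of the pattern. *)
Definition delete_vertex (t : nat) (h : nat -> nat -> bool) (i j : nat) : bool :=
  h (bump t i) (bump t j).

Definition drop_at {T : Type} {k} (t : 'I_k.+1) (f : {ffun 'I_k.+1 -> T})
  : {ffun 'I_k -> T} := [ffun i => f (lift t i)].

Section Embeddings.
Context {T : finType} (G : sgraph T).
Implicit Types (h : nat -> nat -> bool) (xi : nat -> bool).

(** Testing the pairs i < j allows an arbitrary relation as a pattern. *)
Definition embeds {k} h (f : {ffun 'I_k -> T}) : bool :=
  [forall i : 'I_k, forall j : 'I_k,
     (i < j)%N ==> (f i != f j) && (adj G (f i) (f j) == h i j)].

Definition embeddings k h : {set {ffun 'I_k -> T}} := [set f | embeds h f].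

(** The possible images of a new vertex, whose adjacency to the i-th vertex of
    the pattern is xi i, when only the first t constraints are taken into
    account. *)
Definition candidates {k} (f : {ffun 'I_k -> T}) xi (t : nat) : {set T} :=
  [set w | [forall i : 'I_k, (i < t)%N ==> (adj G w (f i) == xi i)]].

Lemma embedsP {k} h (f : {ffun 'I_k -> T}) :
  reflect (forall i j : 'I_k, (i < j)%N -> f i <> f j /\ adj G (f i) (f j) = h i j)
          (embeds h f).
Proof.
apply: (iffP forallP) => [H i j ij|H i].
  have /forallP/(_ j) := H i; rewrite ij /= => /andP[/eqP ? /eqP ?]; by split.
apply/forallP => j; apply/implyP => /H[/eqP-> ->] /=.
by rewrite eqxx.
Qed.

Lemma candidatesP {k} (f : {ffun 'I_k -> T}) xi t w :
  reflect (forall i : 'I_k, (i < t)%N -> adj G w (f i) = xi i)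
          (w \in candidates f xi t).
Proof.
rewrite inE; apply: (iffP forallP) => H i; first by
  move=> it; have := H i; rewrite it => /eqP.
by apply/implyP => /H ->.
Qed.

Lemma candidates0 {k} (f : {ffun 'I_k -> T}) xi : candidates f xi 0 = [set: T]%SET.
Proof. by apply/finset.setP => w; rewrite finset.in_setT; apply/candidatesP. Qed.

Lemma candidatesS {k} (f : {ffun 'I_k -> T}) xi (t : 'I_k) :
  candidates f xi t.+1 =
    (candidates f xi t :&: [set w | adj G w (f t) == xi t])%SET.
Proof.
apply/finset.setP => w; rewrite finset.in_setI [X in _ && X]inE.
apply/candidatesP/andP => [H|[/candidatesP H /eqP Ht] i].
  split; last by rewrite H.
  by apply/candidatesP => i it; apply: H; rewrite ltnS ltnW.
by rewrite ltnS leq_eqVlt => /orP[/eqP/val_inj-> //|/H].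
Qed.

Lemma embeds_drop_at {k} h (t : 'I_k.+1) (f : {ffun 'I_k.+1 -> T}) :
  embeds h f -> embeds (delete_vertex t h) (drop_at t f).
Proof.
move=> /embedsP H; apply/embedsP => i j ij; rewrite !ffunE.
apply: H => /=; rewrite /bump.
by move: ij; case: leqP; case: leqP => //=; lia.
Qed.

Lemma candidates_drop_at {k} xi (t : 'I_k.+1) (f : {ffun 'I_k.+1 -> T}) (u : nat) :
  (u <= t)%N -> candidates (drop_at t f) xi u = candidates f xi u.
Proof.
move=> ut.
have lift_below (j : 'I_k) : (j < u)%N -> lift t j = j :> nat.
  by move=> ju; rewrite /= /bump leqNgt (leq_trans ju ut).
apply/finset.setP => w; apply/candidatesP/candidatesP => H i iu; last first.
  by rewrite ffunE H lift_below.
case: (unliftP t i) => [j e|e]; last by rewrite e ltnNge ut in iu.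
have ju : (j < u)%N.
  by move: iu; rewrite e /= /bump; case: leqP => //=; lia.
by have := H j ju; rewrite ffunE -e => ->; rewrite e lift_below.
Qed.

Lemma drop_at_inj {k} (t : 'I_k.+1) (f g : {ffun 'I_k.+1 -> T}) :
  f t = g t -> drop_at t f = drop_at t g -> f = g.
Proof.
move=> ft fg; apply/ffunP => i; case: (unliftP t i) => [j ->|-> //].
by move/ffunP/(_ j): fg; rewrite !ffunE.
Qed.

(** The set B may depend on the images of all vertices but t, and forgetting t
    turns an embedding of h into an embedding of h minus t.  This is how
    embeddings with a bad choice at t are counted without any information on
    the constraints between t and the later vertices. *)
Lemma card_embeddings_in {k} h (t : 'I_k.+1)
    (B : {ffun 'I_k -> T} -> {set T}) (b : nat) :
  (forall g, embeds (delete_vertex t h) g -> (#|B g| <= b)%N) ->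
  (#|[set f in embeddings k.+1 h | f t \in B (drop_at t f)]|
     <= #|embeddings k (delete_vertex t h)| * b)%N.
Proof.
move=> Bb.
pose S := [set u : {ffun 'I_k -> T} * T | (u.1 \in embeddings k (delete_vertex t h))
                                        && (u.2 \in B u.1)]%SET.
apply: (@leq_trans #|S|).
  rewrite -(@card_in_imset _ _ (fun f : {ffun 'I_k.+1 -> T} => (drop_at t f, f t))).
    apply/subset_leq_card/fintype.subsetP => u /imsetP[f].
    rewrite !inE => /andP[ef fB] -> /=; rewrite fB andbT.
    exact: embeds_drop_at.
  by move=> f g _ _ [e1 e2]; apply: drop_at_inj e1.
have -> : #|S| = \sum_(g in embeddings k (delete_vertex t h)) #|B g|.
  rewrite -sum1_card (eq_bigl (fun u => (u.1 \in embeddings k (delete_vertex t h))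
     && (u.2 \in B u.1))); last by move=> u; rewrite inE.
  rewrite -(pair_big_dep (mem (embeddings k (delete_vertex t h))) (fun g v => v \in B g)
    (fun _ _ => 1%N)) /=.
  by apply: eq_bigr => g _; rewrite sum1_card.
rewrite -sum_nat_const; apply: leq_sum => g; rewrite inE; exact: Bb.
Qed.

Lemma embeds_delete_max {k} h (f : {ffun 'I_k -> T}) :
  embeds (delete_vertex k h) f = embeds h f.
Proof.
have bump_small (i : 'I_k) : bump k i = i by rewrite /bump leqNgt ltn_ord.
by apply/embedsP/embedsP => H i j /H; rewrite /delete_vertex !bump_small.
Qed.

(** The predicate Q makes the same identity usable for the embeddings all of
    whose choices are good, and for the others. *)
Lemma card_embeddingsS m h (Q : pred {ffun 'I_m -> T}) :
  #|[set f in embeddings m.+1 h | Q (drop_at ord_max f)]|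
  = \sum_(g in embeddings m h | Q g)
    #|candidates g (h^~ m) m :\: [set g i | i : 'I_m]|%SET.
Proof.
pose X (g : {ffun 'I_m -> T}) := (candidates g (h^~ m) m :\: [set g i | i : 'I_m])%SET.
pose S := [set u : {ffun 'I_m -> T} * T 
  | (u.1 \in embeddings m h) && Q u.1 && (u.2 \in X u.1)]%SET.
have lift_max_id (i : 'I_m) : lift ord_max i = i :> nat.
  by rewrite /= /bump leqNgt ltn_ord.
have <- : #|S| = \sum_(g in embeddings m h | Q g) #|X g|.
  rewrite -sum1_card (eq_bigl (fun u => (u.1 \in embeddings m h) && Q u.1
     && (u.2 \in X u.1))); last by move=> u; rewrite inE.
  rewrite -(pair_big_dep (fun g => (g \in embeddings m h) && Q g) (fun g v => v \in X g)
    (fun _ _ => 1%N)) /=.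
  by apply: eq_bigr => g _; rewrite sum1_card.
rewrite -(@card_in_imset _ _ (fun f : {ffun 'I_m.+1 -> T} =>
    (drop_at ord_max f, f ord_max))); last first.
  by move=> f g _ _ [e1 e2]; apply: drop_at_inj e1.
apply: eq_card => -[g v]; apply/imsetP/idP => [[f]|].
  rewrite !inE => /andP[ef Qf] [-> ->] /=; rewrite Qf andbT.
  rewrite -embeds_delete_max embeds_drop_at //=; move/embedsP in ef.
  apply/andP; split.
    apply/imsetP => -[i _]; rewrite ffunE => /esym.
    by case: (ef (lift ord_max i) ord_max); rewrite ?lift_max_id.
  apply/forallP => i; apply/implyP => _; rewrite ffunE adjC.
  by case: (ef (lift ord_max i) ord_max) => [|_ ->]; rewrite lift_max_id.
rewrite !inE /= => /andP[/andP[eg Qg] /andP[vg vc]].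
pose f : {ffun 'I_m.+1 -> T} := [ffun i => if unlift ord_max i is Some j then g j else v].
have fl j : f (lift ord_max j) = g j by rewrite ffunE liftK.
have fm : f ord_max = v by rewrite ffunE unlift_none.
have dg : drop_at ord_max f = g by apply/ffunP => i; rewrite ffunE fl.
exists f; last by rewrite dg fm.
rewrite !inE dg Qg andbT; apply/embedsP => i j.
case: (unliftP ord_max i) => [i' ->|->]; last first.
  by rewrite /= => mj; have := ltn_ord j; rewrite ltnS leqNgt mj.
case: (unliftP ord_max j) => [j' ->|->]; rewrite ?fl ?fm !lift_max_id => ij.
  by move/embedsP: eg; apply.
split.
  by move=> e; move/imsetP: vg; apply; exists i'.
move/forallP/(_ i'): vc; rewrite ltn_ord /= adjC => /eqP->.
by [].
Qed.

Lemma card_ordinal_image m (g : {ffun 'I_m -> T}) : (#|[set g i | i : 'I_m]%SET| <= m)%N.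
Proof. by rewrite (leq_trans (leq_imset_card _ _))// card_ord. Qed.

End Embeddings.

(** * Size of the candidate sets of a well split map *)

Section Bernoulli.
Context {R : realFieldType}.
Implicit Type x : R.

Lemma bernoulli_lower x (k : nat) : 0 <= x <= 1 -> 1 - k%:R * x <= (1 - x) ^+ k.
Proof.
move=> /andP[x0 x1]; elim: k => [|k IH]; first by rewrite expr0 mul0r subr0.
have k0 : 0 <= k%:R :> R by [].
apply: (@le_trans _ _ ((1 - k%:R * x) * (1 - x))).
  by rewrite -natr1; nra.
by rewrite exprSr ler_wpM2r// subr_ge0.
Qed.

Lemma bernoulli_upper x (k : nat) : 0 <= x -> k%:R * x <= 1 / 2 ->
  (1 + x) ^+ k <= 1 + 2 * k%:R * x.
Proof.
move=> x0; elim: k => [|k IH]; first by rewrite expr0 mulr0 mul0r addr0.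
have k0 : 0 <= k%:R :> R by [].
rewrite -natr1 => kx.
apply: (@le_trans _ _ ((1 + 2 * k%:R * x) * (1 + x))); last by nra.
by rewrite exprSr ler_wpM2r//; [lra|apply: IH; nra].
Qed.
End Bernoulli.

Section Weight.
Context {R : comPzRingType}.
Variable p : R.
Implicit Type h : nat -> nat -> bool.

Definition pair_prob (b : bool) : R := if b then p else 1 - p.

(** Probability that a random graph of density p has pattern h on m given
    vertices. *)
Definition weight (m : nat) h : R :=
  \prod_(i < m) \prod_(j < m) if (i < j)%N then pair_prob (h i j) else 1.

Lemma weight_delete m (t : 'I_m.+1) h :
  weight m.+1 h = weight m (delete_vertex t h) *
    \prod_(i < m) pair_prob (if (lift t i < t)%N then h (lift t i) t
                                               else h t (lift t i)).
Proof.
rewrite /weight (bigD1_ord t)//= (bigD1_ord t)//= ltnn mul1r mulrC.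
under eq_bigr do rewrite (bigD1_ord t)//=.
rewrite big_split /= [X in X * _]mulrC -mulrA -big_split /=; congr (_ * _).
  apply: eq_bigr => i _; apply: eq_bigr => j _.
  by rewrite /delete_vertex !ltnNge leq_bump2.
apply: eq_bigr => i _.
case: (ltngtP (bump t i) t) => [||e]; rewrite ?mulr1 ?mul1r //.
by have := neq_bump t i; rewrite e eqxx.
Qed.

Lemma weightS m h :
  weight m.+1 h = weight m h * \prod_(i < m) pair_prob (h i m).
Proof.
rewrite (weight_delete _ ord_max).
have lift_max_id (i : 'I_m) : lift ord_max i = i :> nat.
  by rewrite /= /bump leqNgt ltn_ord.
congr (_ * _); last by apply: eq_bigr => i _; rewrite lift_max_id ltn_ord.
rewrite /weight; apply: eq_bigr => i _; apply: eq_bigr => j _.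
have bump_small (k : 'I_m) : bump m k = k by exact: lift_max_id.
by rewrite /delete_vertex /= !bump_small.
Qed.
End Weight.

Section Counting.
Context {R : realFieldType} {T : finType}.
Variables (G : sgraph T) (p q : R).
Hypotheses (q_gt0 : 0 < q) (q_le_p : q <= p) (q_le_1p : q <= 1 - p).
Local Notation n := (@GRing.natmul R 1 #|T|).
Local Notation P := (pair_prob p).
Implicit Types (h : nat -> nat -> bool) (xi : nat -> bool) (A : {set T}).

Lemma q_le_pair_prob b : q <= P b.
Proof. by rewrite /pair_prob; case: b. Qed.

Lemma pair_prob_gt0 b : 0 < P b.
Proof. exact: lt_le_trans (q_le_pair_prob b). Qed.

Lemma weight_gt0 m h : 0 < weight p m h.
Proof.
by do 2! (apply: prodr_gt0 => ? _); case: ifP => _; rewrite ?pair_prob_gt0.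
Qed.

(** Vertex t takes part in m pairs, each of probability at least q. *)
Lemma weight_delete_le m (t : 'I_m.+1) h :
  weight p m (delete_vertex t h) * q ^+ m <= weight p m.+1 h.
Proof.
rewrite (weight_delete _ _ t) ler_pM2l ?weight_gt0//.
rewrite -[m in q ^+ m]card_ord -prodr_const; apply: ler_prod => i _.
by rewrite ltW// q_le_pair_prob.
Qed.

Variables eta c : R.
Hypothesis eta_gt0 : 0 < eta.

(** The set is empty for small A, where the fourth moment says nothing; then its
    size is bounded uniformly in A. *)
Definition bad_choices A : {set T} :=
  if c <= #|A|%:R then splits_badly G p eta A else finset.set0.

Definition well_split {k} (f : {ffun 'I_k -> T}) xi : bool :=
  [forall t : 'I_k, f t \notin bad_choices (candidates G f xi t)].

(** The deviation for non-neighbours is the opposite of the one for neighbours,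
    so a single bad set serves for both values of b. *)
Lemma card_split A x b : x \notin splits_badly G p eta A ->
  `| #|A :&: [set w | adj G w x == b]|%:R - P b * #|A|%:R | <= eta * #|A|%:R.
Proof.
rewrite inE -leNgt; congr (_ <= _).
have -> : #|A :&: [set w | adj G w x == b]|%:R
    = \sum_(w in A) (adj G w x == b)%:R :> R.
  rewrite -sum1_card natr_sum big_mkcond [RHS]big_mkcond /=.
  by apply: eq_bigr => w _; rewrite !inE; case: (w \in A) => //=; case: eqP.
have -> : P b * #|A|%:R = \sum_(w in A) P b by rewrite sumr_const mulr_natr.
rewrite -sumrB; case: b.
  by congr (`|_|); apply: eq_bigr => w _; rewrite /centred_adj adjC; case: adj.
rewrite -normrN -sumrN; congr (`|_|); apply: eq_bigr => w _.
by rewrite /centred_adj adjC /pair_prob; case: adj => /=; ring.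
Qed.

(** Each good split multiplies the size by a factor P * (1 +- eta / q), since
    q <= P.  The lower bound at t is also what keeps the candidate set larger
    than c, so that the next choice is tested against it. *)
Lemma card_candidates {k} (f : {ffun 'I_k -> T}) xi :
  k%:R * (eta / q) <= 1 / 2 -> c <= n * q ^+ k / 2 ->
  well_split f xi ->
  forall t : nat, (t <= k)%N ->
    n * \prod_(i < t) P (xi i) * (1 - eta / q) ^+ t
      <= #|candidates G f xi t|%:R
      <= n * \prod_(i < t) P (xi i) * (1 + eta / q) ^+ t.
Proof.
set x := eta / q => kx ck /forallP wf.
have x0 : 0 < x by rewrite divr_gt0.
have q1 : q <= 1 by have := q_gt0; have := q_le_p; have := q_le_1p; lra.
elim=> [_|t IH tk].
  by rewrite candidates0 cardsT big_ord0 !expr0 !mulr1 lexx.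
have {IH}/andP[lo up] := IH (ltnW tk).
pose t' := Ordinal tk; set A := candidates G f xi t in lo up *.
rewrite (candidatesS G f xi t') -/A.
have tk1 : (t%:R : R) <= k%:R by rewrite ler_nat ltnW.
have k1 : (1 : R) <= k%:R by rewrite ler1n (leq_ltn_trans _ tk).
have x12 : x <= 1 / 2 by nra.
have cA : c <= #|A|%:R.
  apply: le_trans ck (le_trans _ lo).
  have qt : q ^+ k <= \prod_(i < t) P (xi i).
    apply: (@le_trans _ _ (q ^+ t)); first by rewrite ler_wiXn2l ?(ltW q_gt0) ?(ltnW tk).
    rewrite -[t in q ^+ t]card_ord -prodr_const; apply: ler_prod => i _.
    by rewrite ltW// q_le_pair_prob.
  have b : 1 / 2 <= (1 - x) ^+ t.
    apply: le_trans (bernoulli_lower x t _); last by lra.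
    by have := ler_wpM2r (ltW x0) tk1; lra.
  rewrite -mulrA -[leRHS]mulrA ler_wpM2l// ler_pM//.
  - by rewrite exprn_ge0// ltW.
  - by lra.
have : f t' \notin splits_badly G p eta A by have := wf t'; rewrite /bad_choices cA.
move=> /(card_split _ _ (xi t)); rewrite ler_distl.
set a := #|A|%:R in lo up *; move=> /andP[lo' up'].
have a0 : 0 <= a by [].
have ex : eta * a <= P (xi t) * a * x.
  have -> : eta = q * x by rewrite /x mulrC divfK// gt_eqF.
  by rewrite mulrAC (ler_wpM2r (ltW x0))// ler_wpM2r// q_le_pair_prob.
have Pt := pair_prob_gt0 (xi t).
rewrite big_ord_recr /= !exprSr.
apply/andP; split.
- apply: (@le_trans _ _ (P (xi t) * (1 - x) * a)); last by lra.
  have P0 : 0 <= P (xi t) * (1 - x) by rewrite mulr_ge0 ?(ltW Pt)//; lra.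
  by have := ler_wpM2l P0 lo; congr (_ <= _); ring.
- apply: (@le_trans _ _ (P (xi t) * (1 + x) * a)); first by lra.
  have P0 : 0 <= P (xi t) * (1 + x) by rewrite mulr_ge0 ?(ltW Pt)//; lra.
  by have := ler_wpM2l P0 up; congr (_ <= _); ring.
Qed.

Lemma card_extensions {k} (f : {ffun 'I_k -> T}) xi :
  k%:R * (eta / q) <= 1 / 2 -> c <= n * q ^+ k / 2 ->
  well_split f xi ->
  n * \prod_(i < k) P (xi i) * (1 - k%:R * (eta / q)) - k%:R
    <= #|candidates G f xi k :\: [set f i | i : 'I_k]|%:R
    <= n * \prod_(i < k) P (xi i) * (1 + 2 * k%:R * (eta / q)).
Proof.
move=> kx ck wf.
have /andP[lo up] := card_candidates f xi kx ck wf k (leqnn k).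
set Z := n * _ in lo up *.
set A := candidates G f xi k in lo up *; set x := eta / q in kx lo up *.
have x0 : 0 < x by rewrite divr_gt0.
have Z0 : 0 <= Z.
  by rewrite mulr_ge0// prodr_ge0// => i _; rewrite ltW// pair_prob_gt0.
apply/andP; split; last first.
  apply: (@le_trans _ _ #|A|%:R).
    by rewrite ler_nat subset_leq_card// subsetDl.
  by apply: le_trans up _; rewrite ler_wpM2l// bernoulli_upper// ltW.
have x1 : 0 <= x <= 1 \/ k = 0%N.
  have [k0|k0] := posnP k; [by right|left].
  by have : (1 : R) <= k%:R; [rewrite ler1n|nra].
have lo' : Z * (1 - k%:R * x) <= #|A|%:R.
  apply: le_trans lo; rewrite ler_wpM2l//.
  case: x1 => [|k0]; first exact: bernoulli_lower.
  by rewrite k0 mul0r subr0 expr0.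
apply: (@le_trans _ _ (#|A|%:R - k%:R)); first by lra.
rewrite lerBlDr -natrD ler_nat.
rewrite -(cardsID [set f i | i : 'I_k]%SET A) addnC leq_add2l.
apply: leq_trans (card_ordinal_image _ f); exact: subset_leq_card (finset.subsetIr _ _).
Qed.

End Counting.

(** * Induction on the number of vertices *)

Lemma card_exists_le {S I : finType} (A : {set S}) (Q : I -> pred S) :
  (#|[set f in A | [exists t, Q t f]]| <= \sum_t #|[set f in A | Q t f]|)%N.
Proof.
have cardE (B : pred S) : #|[set f in A | B f]| = (\sum_(f in A) B f)%N.
  rewrite -sum1_card big_mkcond [RHS]big_mkcond.
  by apply: eq_bigr => f _; rewrite !inE; case: (f \in A); case: (B f).
rewrite cardE (eq_bigr (fun t => \sum_(f in A) Q t f)%N); last by move=> t _; rewrite cardE.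
rewrite exchange_big; apply: leq_sum => f _.
case: existsP => // -[t Qt].
by rewrite (bigD1 t)//= Qt.
Qed.

Section Induction.
Context {R : realFieldType} {T : finType}.
Variables (G : sgraph T) (p q : R).
Hypotheses (q_gt0 : 0 < q) (q_le_p : q <= p) (q_le_1p : q <= 1 - p).
Local Notation n := (@GRing.natmul R 1 #|T|).
Local Notation P := (pair_prob p).
Implicit Types (h : nat -> nat -> bool) (xi : nat -> bool) (A : {set T}).

Variables (eta : R) (s b : nat).
Let c : R := n * q ^+ s / 2.
Hypotheses (eta_gt0 : 0 < eta) (T_gt0 : (0 < #|T|)%N).
Hypothesis card_bad_le : forall A, (#|bad_choices G p eta c A| <= b)%N.

(** A power of n in place of a falling factorial, so that one more vertex
    contributes a factor n. *)
Definition expected_embeddings m h : R := n ^+ m * weight p m h.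
Local Notation E := expected_embeddings.
Local Notation N m h := (@GRing.natmul R 1 #|embeddings G m h|).

Let n_gt0 : 0 < n. Proof. by rewrite ltr0n. Qed.

Lemma expected_gt0 m h : 0 < E m h.
Proof. by rewrite mulr_gt0 ?exprn_gt0 ?(weight_gt0 _ _ q_gt0). Qed.

Lemma expectedS m h :
  E m.+1 h = E m h * (n * \prod_(i < m) P (h i m)).
Proof. by rewrite /expected_embeddings weightS exprSr mulrACA. Qed.

Lemma expected_delete_le m (t : 'I_m.+1) h :
  E m (delete_vertex t h) * (n * q ^+ m) <= E m.+1 h.
Proof.
rewrite /expected_embeddings mulrACA -exprSr ler_wpM2l ?exprn_ge0//.
exact: weight_delete_le.
Qed.

Let lost_rate := s%:R * b%:R / (n * q ^+ s).

(** Union bound over the vertex t whose image is bad.  Deleting t divides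
    the expected count by at least n * q ^ s, while only b images of t are bad;
    the factor 2 comes from the crude bound on the counts of smaller patterns. *)
Lemma card_bad_embeddings k h xi : (k <= s)%N ->
  (forall j h', (j < k)%N -> N j h' <= 2 * E j h') ->
  #|[set f in embeddings G k h |
      [exists t : 'I_k, f t \in bad_choices G p eta c (candidates G f xi t)]]|%:R
  <= 2 * lost_rate * E k h.
Proof.
have nqs : 0 < n * q ^+ s by rewrite mulr_gt0 ?exprn_gt0.
case: k => [|k] ks N2.
  rewrite (_ : [set f in _ | _] = finset.set0).
    rewrite cards0; apply: mulr_ge0; last exact/ltW/expected_gt0.
    apply: mulr_ge0 => //; apply: divr_ge0; first exact: mulr_ge0.
    exact: ltW.
  by apply/finset.setP => f; rewrite !inE andbC; case: existsP => // -[[]].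
have q1 : q <= 1 by have := q_gt0; have := q_le_p; have := q_le_1p; lra.
have Ek : 0 < E k.+1 h := expected_gt0 _ _.
apply: (@le_trans _ _ (\sum_(t < k.+1) 2 * (b%:R / (n * q ^+ s)) * E k.+1 h)).
  apply: (@le_trans _ _ (\sum_(t < k.+1) #|[set f in embeddings G k.+1 h |
      f t \in bad_choices G p eta c (candidates G f xi t)]|%:R)).
    by rewrite -natr_sum ler_nat card_exists_le.
  apply: ler_sum => t _.
  apply: (@le_trans _ _ (N k (delete_vertex t h) * b%:R)).
    rewrite -natrM ler_nat.
    pose B (g : {ffun 'I_k -> T}) := bad_choices G p eta c (candidates G g xi t).
    have Bb g : embeds G (delete_vertex t h) g -> (#|B g| <= b)%N by move=> _; exact: card_bad_le.
    apply: leq_trans (card_embeddings_in G h t B b Bb).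
    apply/subset_leq_card/fintype.subsetP => f; rewrite !inE.
    by rewrite /B candidates_drop_at.
  apply: (@le_trans _ _ (2 * b%:R * E k (delete_vertex t h))).
    by rewrite mulrAC ler_wpM2r// N2.
  have <- : 2 * b%:R * (E k.+1 h / (n * q ^+ s))
            = 2 * (b%:R / (n * q ^+ s)) * E k.+1 h by ring.
  rewrite ler_wpM2l ?mulr_ge0// ler_pdivlMr//.
  apply: le_trans (expected_delete_le k t h).
  rewrite ler_wpM2l ?(ltW (expected_gt0 _ _))// ler_wpM2l//.
  by rewrite ler_wiXn2l ?(ltW q_gt0) ?(ltnW ks).
rewrite sumr_const card_ord -[leLHS]mulr_natl /lost_rate.
have -> : 2 * (s%:R * b%:R / (n * q ^+ s)) * E k.+1 h
          = s%:R * (2 * (b%:R / (n * q ^+ s)) * E k.+1 h) by ring.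
rewrite ler_wpM2r ?ler_nat//; apply: mulr_ge0; last exact: ltW.
by apply: mulr_ge0 => //; apply: divr_ge0 => //; exact: ltW.
Qed.

Let x := eta / q.
Let split_error := 2 * s%:R * x + s%:R / (n * q ^+ s).

(** Relative error caused by one more vertex: the first term comes from the
    splits; in the second one, 1 stands for the vertices that are already used
    and b for the bad choices. *)
Definition step_error : R := 2 * s%:R * (eta / q) + s%:R * (1 + b%:R) / (n * q ^+ s).
Hypothesis error_small : s%:R * (2 * step_error) <= 1.

(** Fix the images of the first m vertices.  If they are well split, the number
    of images of the last vertex is known up to the relative error split_error.
    For the upper bound, the embeddings of m + 1 vertices that are not well
    split on the first m are few; for the lower bound, the embeddings of m
    vertices that are not well split are few.  Both follow from
    [card_bad_embeddings], applied to m + 1 and to m vertices. *)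
Theorem embeddings_estimate m h : (m <= s)%N ->
  `| N m h - E m h | <= m%:R * (2 * step_error) * E m h.
Proof.
elim/ltn_ind: m h => -[_ h _|m IH h ms].
  have -> : N 0 h = 1.
    rewrite (_ : embeddings G 0 h = [set: _]%SET).
      by rewrite cardsT card_ffun card_ord expn0.
    by apply/finset.setP => f; rewrite !inE; apply/embedsP => -[].
  by rewrite /expected_embeddings /weight big_ord0 expr0 mulr1 subrr normr0 !mul0r.
have nqs : 0 < n * q ^+ s by rewrite mulr_gt0 ?exprn_gt0.
have x0 : 0 < x by rewrite divr_gt0.
have q1 : q <= 1 by have := q_gt0; have := q_le_p; have := q_le_1p; lra.
have s1 : (1 : R) <= s%:R by rewrite ler1n (leq_ltn_trans _ ms).
have lost_rate0 : 0 <= lost_rate by apply: divr_ge0; [exact: mulr_ge0|exact: ltW].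
have split_error0 : 0 <= split_error.
  apply: addr_ge0; first by apply: mulr_ge0; [exact: mulr_ge0|exact: ltW].
  by apply: divr_ge0 => //; exact: ltW.
have epsE : step_error = split_error + lost_rate.
  by rewrite /step_error /split_error /lost_rate /x; ring.
have e12 : step_error <= 1 / 2 by have := error_small; nra.
have sx : s%:R * x <= 1 / 2.
  have : 0 <= s%:R / (n * q ^+ s) by rewrite divr_ge0// ltW.
  by move: e12 lost_rate0; rewrite epsE /split_error; lra.
have ke (k : nat) : (k <= s)%N -> k%:R * (2 * step_error) <= 1.
  move=> ks; apply: le_trans error_small; rewrite ler_wpM2r ?ler_nat//.
  by rewrite epsE; lra.
have N2 (k : nat) h' : (k < m.+1)%N -> N k h' <= 2 * E k h'.
  move=> km; have ks : (k <= s)%N by apply: ltnW (leq_trans km ms).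
  have := IH k km h' ks; rewrite ler_distl => /andP[_]/le_trans; apply.
  by have := ler_wpM2r (ltW (expected_gt0 k h')) (ke k ks); lra.
pose xi : nat -> bool := h^~ m.
pose Z : R := n * \prod_(i < m) P (xi i).
have ES : E m.+1 h = E m h * Z := expectedS m h.
have Em : 0 < E m h := expected_gt0 _ _.
have EmS : 0 < E m.+1 h := expected_gt0 _ _.
have qsm : q ^+ s <= q ^+ m by rewrite ler_wiXn2l ?(ltW q_gt0) ?(ltnW ms).
have Zq : n * q ^+ s <= Z.
  rewrite ler_pM2l//; apply: le_trans qsm _.
  rewrite -[m in q ^+ m]card_ord -prodr_const; apply: ler_prod => i _.
  by rewrite ltW// q_le_pair_prob.
have Z0 : 0 < Z by apply: lt_le_trans Zq.
have ms' : (m%:R : R) <= s%:R by rewrite ler_nat ltnW.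
have mx : m%:R * (eta / q) <= 1 / 2.
  by apply: le_trans sx; rewrite ler_wpM2r// ltW.
have cm : c <= n * q ^+ m / 2 by rewrite /c ler_wpM2r// ler_pM2l.
pose W (g : {ffun 'I_m -> T}) := well_split G p eta c g xi.
pose X g := #|candidates G g xi m :\: [set g i | i : 'I_m]|%SET.
have XW g : W g -> Z * (1 - split_error) <= (X g)%:R <= Z * (1 + split_error).
  move=> Wg; have := card_extensions G p q q_gt0 q_le_p q_le_1p eta c eta_gt0 g xi mx cm Wg.
  rewrite -/Z -/x -/(X g) => /andP[lo up].
  have mxs : m%:R * x <= s%:R * x by rewrite ler_wpM2r// ltW.
  have sn0 : 0 <= s%:R / (n * q ^+ s) by rewrite divr_ge0// ltW.
  have sZ : m%:R <= Z * (s%:R / (n * q ^+ s)).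
    apply: le_trans ms' _; rewrite mulrA [Z * _]mulrC -mulrA ler_peMr//.
    by rewrite ler_pdivlMr// mul1r.
  have Zmx := ler_wpM2l (ltW Z0) mxs.
  have Zsx : 0 <= Z * (s%:R * x) by apply: mulr_ge0; [exact: ltW|apply: mulr_ge0 => //; exact: ltW].
  have Zsn := mulr_ge0 (ltW Z0) sn0.
  rewrite /split_error; move: (s%:R / _) sn0 sZ Zsn => sn sn0 sZ Zsn.
  apply/andP; split; first by apply: le_trans lo; lra.
  by apply: le_trans up _; lra.
have NS : N m.+1 h = (\sum_(g in embeddings G m h | W g) X g)%:R
   + #|[set f in embeddings G m.+1 h | ~~ W (drop_at ord_max f)]|%:R.
  rewrite -(card_embeddingsS G m h W) -natrD; congr (_%:R).
  rewrite -[LHS](cardsID [set f | W (drop_at ord_max f)]%SET); congr (_ + _)%N.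
    by apply: eq_card => f; rewrite !inE.
  by apply: eq_card => f; rewrite !inE andbC.
have Nsplit : N m h = #|[set g in embeddings G m h | W g]|%:R
   + #|[set g in embeddings G m h | ~~ W g]|%:R.
  rewrite -natrD; congr (_%:R).
  rewrite -[LHS](cardsID [set f | W f]%SET); congr (_ + _)%N.
    by apply: eq_card => f; rewrite !inE.
  by apply: eq_card => f; rewrite !inE andbC.
have lostS : #|[set f in embeddings G m.+1 h | ~~ W (drop_at ord_max f)]|%:R
    <= 2 * lost_rate * E m.+1 h.
  apply: le_trans (card_bad_embeddings m.+1 h xi ms N2).
  rewrite ler_nat; apply/subset_leq_card/fintype.subsetP => f.
  rewrite !inE => /andP[-> /=]; rewrite negb_forall => /existsP[t].
  rewrite negbK ffunE candidates_drop_at; last exact: ltnW.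
  have lt : lift ord_max t = t :> nat by rewrite /= /bump leqNgt ltn_ord.
  by move=> ft; apply/existsP; exists (lift ord_max t); rewrite lt.
have lost : #|[set g in embeddings G m h | ~~ W g]|%:R <= 2 * lost_rate * E m h.
  apply: le_trans (card_bad_embeddings m h xi (ltnW ms) _).
    rewrite ler_nat; apply/subset_leq_card/fintype.subsetP => g.
    rewrite !inE => /andP[-> /=]; rewrite negb_forall => /existsP[t].
    by rewrite negbK => gt; apply/existsP; exists t.
  by move=> j h' jm; apply: N2; exact: ltnW.
have := IH m (ltnSn m) h (ltnW ms); rewrite ler_distl => /andP[Nlo Nup].
set r := 2 * step_error in ke Nlo Nup *.
have rE : r = 2 * (split_error + lost_rate) by rewrite /r epsE.
have mr : m%:R * r <= 1 by exact: ke (ltnW ms).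
set Wn := (X in X + _) in Nsplit.
set S := (X in X%:R + _) in NS.
have WnE : Wn = \sum_(g in embeddings G m h | W g) 1.
  rewrite /Wn -sum1_card natr_sum; apply: eq_bigl => g; by rewrite inE.
have Slo : Z * (1 - split_error) * Wn <= S%:R.
  rewrite WnE mulr_sumr /S natr_sum; apply: ler_sum => g /andP[_ Wg].
  by rewrite mulr1; case/andP: (XW g Wg).
have Sup : S%:R <= Z * (1 + split_error) * Wn.
  rewrite WnE mulr_sumr /S natr_sum; apply: ler_sum => g /andP[_ Wg].
  by rewrite mulr1; case/andP: (XW g Wg).
rewrite -natr1 ler_distl NS ES; apply/andP; split.
  set L := #|_|%:R; have L0 : 0 <= L by [].
  have Wlo : E m h * (1 - m%:R * r - 2 * lost_rate) <= Wn by lra.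
  have e1 : 0 <= 1 - split_error by lra.
  have Ze : 0 <= Z * (1 - split_error) by rewrite mulr_ge0 ?(ltW Z0).
  apply: (@le_trans _ _ (Z * (1 - split_error) * (E m h * (1 - m%:R * r - 2 * lost_rate)))); last first.
    by apply: le_trans (ler_wpM2l Ze Wlo) _; lra.
  have EZ : 0 <= E m h * Z by rewrite mulr_ge0 ?ltW.
  suff : E m h * Z * (1 - (m%:R + 1) * r)
     <= E m h * Z * ((1 - split_error) * (1 - m%:R * r - 2 * lost_rate)) by lra.
  rewrite ler_wpM2l//.
  have mr0 : 0 <= m%:R * r by apply: mulr_ge0 => //; lra.
  by have := mulr_ge0 split_error0 mr0; have := mulr_ge0 split_error0 lost_rate0; lra.
rewrite ES in lostS.
apply: le_trans (lerD Sup lostS) _.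
have Ze : 0 <= Z * (1 + split_error) by rewrite mulr_ge0 ?(ltW Z0)//; lra.
have Wup : Wn <= E m h * (1 + m%:R * r).
  have : 0 <= (#|[set g in embeddings G m h | ~~ W g]|%:R : R) by [].
  by lra.
apply: le_trans (lerD (ler_wpM2l Ze Wup) (lexx _)) _.
have EZ : 0 <= E m h * Z by rewrite mulr_ge0 ?ltW.
suff : E m h * Z * ((1 + split_error) * (1 + m%:R * r) + 2 * lost_rate)
     <= E m h * Z * (1 + (m%:R + 1) * r) by lra.
rewrite ler_wpM2l//.
by have := ler_wpM2l split_error0 mr; lra.
Qed.
End Induction.

(** * From embeddings to induced copies *)

Lemma induced_embeddingP {S T : finType} (H : sgraph S) (G : sgraph T)
    (f : {ffun S -> T}) :
  reflect (injective f /\ forall x y, adj G (f x) (f y) = adj H x y)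
          (induced_embedding H G f).
Proof.
apply: (iffP andP) => -[/injectiveP fi fa]; split=> //.
  by move=> x y; have /forallP/(_ y)/eqP := forallP fa x.
by apply/forallP => x; apply/forallP => y; apply/eqP.
Qed.

Lemma graph_autP {S : finType} (H : sgraph S) (a : {perm S}) :
  reflect (forall x y, adj H (a x) (a y) = adj H x y) (a \in graph_aut H).
Proof.
rewrite inE; apply: (iffP forallP) => ha x; last by apply/forallP => y; apply/eqP.
by move=> y; have /forallP/(_ y)/eqP := ha x.
Qed.

Lemma card_graph_aut_gt0 {S : finType} (H : sgraph S) : (0 < #|graph_aut H|)%N.
Proof. by apply/card_gt0P; exists 1%g; apply/graph_autP => x y; rewrite !perm1. Qed.

(** Two embeddings with the same image differ by an automorphism of H. *)
Lemma card_embeddings_onto {S T : finType} (H : sgraph S) (G : sgraph T)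
    (f0 : {ffun S -> T}) : induced_embedding H G f0 ->
  #|[set f : {ffun S -> T} | induced_embedding H G f
       && (f @: [set: S] == f0 @: [set: S])]%SET| = #|graph_aut H|.
Proof.
move=> /induced_embeddingP[f0i f0a].
rewrite -(@card_imset _ _ (fun a : {perm S} => [ffun x => f0 (a x)])); last first.
  by move=> a b /ffunP ab; apply/permP => x; apply: f0i; have := ab x; rewrite !ffunE.
apply: eq_card => f; rewrite inE.
apply/andP/imsetP => [[/induced_embeddingP[fi fa] /eqP fim]|[a /graph_autP ha ->]].
  have ex x : exists y, f0 y == f x.
    have : f x \in f0 @: [set: S]%SET by rewrite -fim imset_f.
    by case/imsetP => y _ ->; exists y.
  pose a x := xchoose (ex x).
  have aE x : f0 (a x) = f x by apply/eqP; exact: (xchooseP (ex x)).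
  have ai : injective a by move=> x y axy; apply: fi; rewrite -!aE axy.
  exists (perm ai); last by apply/ffunP => x; rewrite ffunE permE aE.
  by apply/graph_autP => x y; rewrite !permE -f0a !aE fa.
split.
  apply/induced_embeddingP; split=> [x y|x y]; rewrite !ffunE.
    by move=> /f0i/perm_inj.
  by rewrite f0a ha.
apply/eqP/finset.setP => v; apply/imsetP/imsetP => -[x _ ->].
  by exists (a x) => //; rewrite ffunE.
by exists (a^-1 x)%g => //; rewrite ffunE permKV.
Qed.

Lemma card_induced_copies {S T : finType} (H : sgraph S) (G : sgraph T) :
  (#|[set f : {ffun S -> T} | induced_embedding H G f]|
   = #|induced_copies H G| * #|graph_aut H|)%N.
Proof.
rewrite -sum1_card.
rewrite (partition_big (fun f : {ffun S -> T} => f @: [set: S])%SET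
  (fun A => A \in induced_copies H G)) /=; last first.
  by move=> f; rewrite !inE => ef; apply/existsP; exists f; rewrite ef eqxx.
rewrite -sum_nat_const; apply: eq_bigr => A; rewrite inE => /existsP[f0 /andP[e0 /eqP <-]].
rewrite sum1_card -(card_embeddings_onto H G f0 e0).
by apply: eq_card => f; rewrite !inE unfold_in /= !inE.
Qed.

Section Ordinal.
Context {s : nat} (H : sgraph 'I_s).

Definition nat_adj (i j : nat) : bool :=
  if (insub i : option 'I_s, insub j : option 'I_s) is (Some u, Some v)
  then adj H u v else false.

Lemma nat_adjE (i j : 'I_s) : nat_adj i j = adj H i j.
Proof. by rewrite /nat_adj !valK. Qed.

Lemma embeddingsE {T : finType} (G : sgraph T) :
  embeddings G s nat_adj = [set f | induced_embedding H G f].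
Proof.
apply/finset.setP => f; rewrite !inE; apply/embedsP/induced_embeddingP.
  move=> hf; split=> x y.
    case: (ltngtP x y) => [/hf[ne _]|/hf[ne _]|/val_inj //] e; first by case: ne.
    by case: ne.
  case: (ltngtP x y) => [/hf[_ ->]|/hf[_]|/val_inj ->]; rewrite ?nat_adjE//.
    by rewrite adjC => ->; rewrite adjC.
  by rewrite !adj_irr.
case=> fi fa i j ij; split; last by rewrite fa nat_adjE.
by move/fi => e; rewrite e ltnn in ij.
Qed.

(** Unordered pairs correspond to ordered pairs with u.1 < u.2; used for the
    edges and for all pairs. *)
Lemma card_ordered_pairs (B : {set {set 'I_s}}) :
  (forall A, A \in B -> #|A| = 2) ->
  #|[set u : 'I_s * 'I_s | (u.1 < u.2)%N && ([set u.1; u.2]%SET \in B)]| = #|B|.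
Proof.
move=> B2; rewrite -(@card_in_imset _ _ (fun u : 'I_s * 'I_s => [set u.1; u.2]%SET)).
  apply: eq_card => A; apply/imsetP/idP => [[u]|AB].
    by rewrite inE => /andP[_ uB] ->.
  have /eqP/cards2P[x [y [xy AE]]] := B2 A AB.
  case: (ltngtP x y) => [lt|lt|/val_inj e]; last by rewrite e eqxx in xy.
    by exists (x, y); rewrite //= inE /= lt -AE AB.
  by exists (y, x); rewrite /= ?inE /= ?lt finset.setUC -AE // AB.
move=> [x y] [x' y']; rewrite !inE /= => /andP[lt _] /andP[lt' _] e.
have := set21 x y; have := set22 x y; rewrite e !inE => /orP[] /eqP ey /orP[] /eqP ex.
- by rewrite ex ey ltnn in lt.
- by subst; move: lt lt'; lia.
- by rewrite ex ey.
- by rewrite ex ey ltnn in lt.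
Qed.

Lemma weight_nat_adj {R : fieldType} (p : R) : 1 - p != 0 ->
  weight p s nat_adj = (p / (1 - p)) ^+ #|edges H| * (1 - p) ^+ 'C(s, 2).
Proof.
move=> p1.
have edges2 A : A \in edges H -> #|A| = 2.
  by move=> AE; have /forall_inP/(_ A AE)/eqP := valP H.
pose B2 := [set A : {set 'I_s} | #|A| == 2]%SET.
have cardB2 : #|B2| = 'C(s, 2) by rewrite card_draws card_ord.
rewrite /weight pair_big /= -big_mkcond /=.
transitivity (\prod_(u : 'I_s * 'I_s | (u.1 < u.2)%N)
    ((if adj H u.1 u.2 then p / (1 - p) else 1) * (1 - p))).
  apply: eq_bigr => u _; rewrite nat_adjE /pair_prob.
  by case: adj; rewrite ?mul1r ?divfK.
rewrite big_split /= -big_mkcondr /= !prodr_const; congr (_ ^+ _ * _ ^+ _).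
  rewrite -(card_ordered_pairs _ edges2); apply: eq_card => u; by rewrite !inE.
rewrite -cardB2 -card_ordered_pairs; last by move=> A; rewrite inE => /eqP.
apply: eq_card => u; rewrite !inE cards2.
rewrite [LHS](_ : _ = (u.1 < u.2)%N)//.
case: ltnP => //= lt; have -> // : u.1 != u.2.
by apply: contraTneq lt => ->; rewrite ltnn.
Qed.
End Ordinal.

Lemma ffact_le_exp (n s : nat) : (n ^_ s <= n ^ s)%N.
Proof.
rewrite ffact_prod -[s in (n ^ s)%N]card_ord -prod_nat_const.
by apply: leq_prod => i _; exact: leq_subr.
Qed.

Lemma ffact_ge {R : realFieldType} (n s : nat) : (0 < n)%N ->
  n%:R ^+ s * (1 - s%:R * (s%:R / n%:R)) <= (n ^_ s)%:R :> R.
Proof.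
move=> n0; have nR : 0 < n%:R :> R by rewrite ltr0n.
have [sn|ns] := leqP s n; last first.
  apply: (@le_trans _ _ 0); last by [].
  rewrite mulr_ge0_le0 ?exprn_ge0// subr_le0.
  have : (1 : R) <= s%:R / n%:R by rewrite ler_pdivlMr// mul1r ler_nat ltnW.
  have : (1 : R) <= s%:R by rewrite ler1n (leq_ltn_trans _ ns).
  by nra.
apply: (@le_trans _ _ (n%:R ^+ s * (1 - s%:R / n%:R) ^+ s)).
  rewrite ler_wpM2l ?exprn_ge0// bernoulli_lower//.
  by rewrite divr_ge0//= ler_pdivrMr// mul1r ler_nat.
rewrite -exprMn mulrBr mulr1 mulrC divfK ?gt_eqF// ffact_prod natr_prod.
rewrite -[s in _ ^+ s]card_ord -prodr_const; apply: ler_prod => i _.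
rewrite subr_ge0 ler_nat sn /= natrB; last by rewrite (leq_trans _ sn) // ltnW.
by rewrite lerD2l lerN2 ler_nat ltnW.
Qed.

(** Passing from n ^ s to the falling factorial adds a relative error s ^ 2 / n,
    which the term s / (n * q ^ s) of eps already dominates. *)
Lemma copies_deviation_le {R : realType} (p q D eta : R) (n s : nat)
    (G : sgraph 'I_n) (H : sgraph 'I_s) :
  0 < q -> q <= p -> q <= 1 - p -> (0 < n)%N -> 0 < eta ->
  pseudorandom4 G p D ->
  let beta := (16 * D + 3 * n%:R / (n%:R * q ^+ s / 2) ^+ 2) / eta ^+ 4 in
  let eps := 2 * s%:R * (eta / q) + s%:R * (1 + beta) / (n%:R * q ^+ s) in
  s%:R * (2 * eps) <= 1 / 2 ->
  copies_deviation p G H <= 4 * (s%:R * (2 * eps)).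
Proof.
move=> q0 qp q1p n0 eta0 Gp beta eps small.
have nR : 0 < n%:R :> R by rewrite ltr0n.
have nqs : 0 < n%:R * q ^+ s by rewrite mulr_gt0 ?exprn_gt0.
have c0 : 0 < n%:R * q ^+ s / 2 by rewrite divr_gt0.
have p01 : 0 < p < 1 by lra.
have p1 : 0 < 1 - p by lra.
have D0 : 0 <= D by exact: codegree_error_ge0 Gp (Ordinal n0).
have beta0 : 0 <= beta.
  rewrite divr_ge0 ?exprn_ge0 ?(ltW eta0)// addr_ge0 ?mulr_ge0//.
  by rewrite invr_ge0 exprn_ge0 ?(ltW c0).
(* The number of bad choices is an integer, and so at most truncn beta. *)
pose b := Num.truncn beta.
have b_le : b%:R <= beta by rewrite truncn_le.
have card_bad_le A : (#|bad_choices G p eta (#|'I_n|%:R * q ^+ s / 2) A| <= b)%N.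
  rewrite truncn_ge_nat// /bad_choices card_ord; case: ifP => cA; last by rewrite cards0.
  have := splits_badly_card G p D p01 Gp eta _ A eta0 c0 cA.
  by rewrite card_ord.
have n0' : (0 < #|'I_n|)%N by rewrite card_ord.
set rho := s%:R * (2 * eps) in small *.
have err : s%:R * (2 * @step_error R 'I_n q eta s b) <= rho.
  rewrite /rho ler_wpM2l// ler_wpM2l// /step_error card_ord lerD2l.
  by rewrite ler_wpM2r ?invr_ge0 ?(ltW nqs)// ler_wpM2l// lerD2l.
have err1 : s%:R * (2 * @step_error R 'I_n q eta s b) <= 1 by lra.
have := embeddings_estimate G p q q0 qp q1p eta s b eta0 n0' card_bad_le err1
  s (nat_adj H) (leqnn s).
rewrite /expected_embeddings card_ord weight_nat_adj; last by rewrite gt_eqF.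
rewrite embeddingsE card_induced_copies natrM /copies_deviation /expected_copies.
rewrite -[X in _ / X]mulrA.
set w := (_ ^+ #|edges H| * _).
have w0 : 0 < w by rewrite mulr_gt0 ?exprn_gt0 ?divr_gt0//; case/andP: p01.
have aut0 : 0 < #|graph_aut H|%:R :> R by rewrite ltr0n card_graph_aut_gt0.
set N := #|induced_copies H G|%:R; set a := #|graph_aut H|%:R in aut0 *.
set K := n%:R ^+ s; set F := (n ^_ s)%:R.
have K0 : 0 < K by rewrite exprn_gt0.
have FK : F <= K by rewrite /F /K -natrX ler_nat ffact_le_exp.
have srho : s%:R * (s%:R / n%:R) <= rho.
  rewrite /rho ler_wpM2l//.
  have q1 : q <= 1 by lra.
  have nq : s%:R / n%:R <= s%:R * (1 + beta) / (n%:R * q ^+ s).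
    rewrite ler_pM ?invr_ge0 ?(ltW nR)//; first by rewrite ler_peMr//; lra.
    by rewrite lef_pV2 ?posrE// ler_piMr ?exprn_ile1 ?(ltW q0)// ltW.
  have e1 : 0 <= 2 * s%:R * (eta / q).
    by rewrite !mulr_ge0 ?invr_ge0 ?(ltW eta0) ?(ltW q0).
  have s0 : 0 <= s%:R / n%:R :> R by rewrite divr_ge0// ltW.
  by rewrite /eps; lra.
have FK' : K * (1 - rho) <= F.
  apply: le_trans (ffact_ge n s n0).
  by rewrite -/K ler_wpM2l ?(ltW K0)//; lra.
have rho0 : 0 <= rho by apply: le_trans srho; rewrite mulr_ge0 ?divr_ge0 ?(ltW nR).
have F0 : 0 < F by apply: lt_le_trans FK'; rewrite mulr_gt0//; lra.
have Kw0 : 0 <= K * w by apply: mulr_ge0; exact: ltW.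
move=> dev.
have {}dev : `|N * a - K * w| <= rho * (K * w).
  by apply: le_trans dev _; rewrite ler_wpM2r.
have -> : N / (F / a * w) - 1 = (N * a - F * w) / (F * w).
  by field; rewrite !gt_eqF.
have Fw0 : 0 < F * w by rewrite mulr_gt0.
rewrite normrM normfV (gtr0_norm Fw0) ler_pdivrMr//.
move: dev; rewrite !ler_distl => /andP[lo up].
have Kw : K * w * (1 - rho) <= F * w by rewrite mulrAC ler_wpM2r ?(ltW w0).
have Fw : F * w <= K * w by rewrite ler_wpM2r ?(ltW w0).
move: (F * w) (K * w) (N * a) Kw Fw Kw0 Fw0 lo up small rho0.
move: (rho) => r X Y Z YX XY Y0 X0 lo up r12 r0.
have r1 : 0 <= 1 - r by lra.
have r4 : 0 <= 1 + 4 * r by lra.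
have rX : 0 <= r * X by rewrite mulr_ge0 ?(ltW X0).
have rY : 0 <= Y * (r * (1 - 2 * r)) by rewrite !mulr_ge0//; lra.
have h1 := ler_wpM2l r1 XY; have h2 := ler_wpM2l r4 YX.
by apply/andP; split; lra.
Qed.

(** * The logarithmic range of sizes *)

Section Gamma.
Context {R : realType}.
Variable p : R.
Hypothesis p01 : 0 < p < 1.

Lemma gamma_gt1 : 1 < gamma p.
Proof.
have [p0 p1] := andP p01.
by rewrite /gamma lt_max invf_gt1// p1.
Qed.

Lemma gamma_gt0 : 0 < gamma p.
Proof. exact: lt_trans ltr01 gamma_gt1. Qed.

Lemma inv_gamma_le : (gamma p)^-1 <= p.
Proof.
have [p0 p1] := andP p01.
by rewrite -[leRHS]invrK lef_pV2 ?posrE ?invr_gt0 ?gamma_gt0// le_max lexx.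
Qed.

Lemma inv_gamma_le1B : (gamma p)^-1 <= 1 - p.
Proof.
have [p0 p1] := andP p01.
have p1' : 0 < 1 - p by lra.
by rewrite -[leRHS]invrK lef_pV2 ?posrE ?invr_gt0 ?gamma_gt0// le_max lexx orbT.
Qed.
End Gamma.

(** The arithmetic of the error for W = gamma ^ s, nu = n, nd = n ^ delta,
    L = log n, g = log gamma, S = s and the tolerance L ^ - 3.  The fourth power
    of the tolerance costs L ^ 12, so a margin L ^ 15 in the first three
    inequalities leaves L ^ - 3 in every term; S ^ 2 <= (L / g) ^ 2 then leaves
    1 / L. *)
Lemma total_error_le {R : realFieldType} (W nu nd L C gam g S : R) :
  0 < W -> 0 < nu -> 0 <= nd -> 1 <= L -> 0 < C -> 0 < gam -> 0 < g -> 0 <= S ->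
  W * L ^+ 15 <= nu -> W * nd * L ^+ 15 <= nu -> W ^+ 3 * L ^+ 15 <= nu ^+ 2 ->
  g * S <= L ->
  S * (2 * (2 * S * ((L ^+ 3)^-1 / gam^-1) +
     S * (1 + (16 * (C * nd) + 3 * nu / (nu * W^-1 / 2) ^+ 2) / (L ^+ 3)^-1 ^+ 4)
       / (nu * W^-1)))
  <= 2 * (2 * gam + 16 * C + 13) / g ^+ 2 / L.
Proof.
move=> W0 nu0 nd0 L1 C0 gam0 g0 S0 h1 h2 h3 hS.
have L0 : 0 < L by lra.
have L2E : L ^+ 3 = L * L ^+ 2 by rewrite exprS.
have u1 : 1 <= L ^+ 3 by rewrite exprn_ege1.
have L15 : L ^+ 15 = L ^+ 3 * (L ^+ 3) ^+ 4 by rewrite -exprM -exprD.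
move: h1 h2 h3; rewrite L15; move: (L ^+ 3) L2E u1 => u uE u1 h1 h2 h3 {L15}.
have u0 : 0 < u by lra.
have b1 : W / nu <= u^-1.
  rewrite ler_pdivrMr// ler_pdivlMl//; apply: le_trans h1.
  by rewrite mulrC ler_pM2l// ler_peMr ?exprn_ege1 ?(ltW u0).
have b2 : u ^+ 4 * (W * nd / nu) <= u^-1.
  rewrite mulrA ler_pdivrMr// ler_pdivlMl//; apply: le_trans h2.
  by rewrite [leLHS]mulrA [leRHS]mulrC.
have b3 : u ^+ 4 * (W ^+ 3 / nu ^+ 2) <= u^-1.
  rewrite mulrA ler_pdivrMr ?exprn_gt0// ler_pdivlMl//; apply: le_trans h3.
  by rewrite [leLHS]mulrA [leRHS]mulrC.
have -> : 2 * S * (u^-1 / gam^-1) +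
     S * (1 + (16 * (C * nd) + 3 * nu / (nu * W^-1 / 2) ^+ 2) / u^-1 ^+ 4)
       / (nu * W^-1)
  = S * (2 * gam * u^-1 + W / nu + 16 * C * (u ^+ 4 * (W * nd / nu))
         + 12 * (u ^+ 4 * (W ^+ 3 / nu ^+ 2))).
  by field; rewrite !gt_eqF.
have Cb2 := ler_wpM2l (ltW C0) b2.
apply: (@le_trans _ _ (S * (2 * (S * ((2 * gam + 16 * C + 13) * u^-1))))).
  by rewrite ler_wpM2l// ler_wpM2l// ler_wpM2l//; lra.
have K0 : 0 <= 2 * gam + 16 * C + 13 by lra.
have SS : (g * S) ^+ 2 <= L ^+ 2 by rewrite lerXn2r ?nnegrE ?mulr_ge0 ?(ltW g0) ?(ltW L0).
rewrite (_ : _ * _ = (2 * (2 * gam + 16 * C + 13)) * (S ^+ 2 / u)); last by ring.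
rewrite -[leRHS]mulrA ler_wpM2l ?mulr_ge0//.
rewrite ler_pdivrMr// -invfM ler_pdivlMl ?mulr_gt0 ?exprn_gt0//.
by rewrite uE mulrAC -exprMn mulrC ler_wpM2l ?(ltW L0).
Qed.

Section Bound.
Context {R : realType}.
Variables (p delta C : R) (n : nat) (G : sgraph 'I_n).
Hypotheses (p01 : 0 < p < 1) (delta01 : 0 < delta < 1) (C_gt0 : 0 < C).
Hypothesis Gp : pseudorandom4 G p (C * n%:R `^ delta).
Local Notation L := (ln (n%:R : R)).
Local Notation g := (ln (gamma p)).
Hypothesis L_ge1 : 1 <= L.

(** Four times the constant of [total_error_le]. *)
Definition rate : R := 8 * (2 * gamma p + 16 * C + 13) / g ^+ 2.

Lemma rate_ge0 : 0 <= rate.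
Proof.
apply: divr_ge0; last exact: exprn_even_ge0.
by have := gamma_gt0 p p01; have := C_gt0; lra.
Qed.

Hypothesis L_large : rate / L <= 2.

(** The range of s gives the three inequalities of [total_error_le] after taking
    logarithms: 1 - delta is used for gamma ^ s * n ^ delta, and 2/3 for
    gamma ^ (3 * s). *)
Lemma copies_deviation_log (s : nat) (H : sgraph 'I_s) :
  s%:R <= Num.min (1 - delta) (2 / 3) * (L / g) - 15 / g * ln L ->
  copies_deviation p G H <= rate / L.
Proof.
move=> s_le.
have g0 : 0 < g by rewrite ln_gt0// gamma_gt1.
have gam0 := gamma_gt0 p p01.
have L0 : 0 < L by apply: lt_le_trans L_ge1.
have n0 : (0 < n)%N.
  by case: (posnP n) => // n0; move: L0; rewrite n0 ln0// ltxx.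
have nR : 0 < n%:R :> R by rewrite ltr0n.
have lnL : 0 <= ln L by rewrite ln_ge0.
set S : R := s%:R in s_le.
have gS : g * S <= Num.min (1 - delta) (2 / 3) * L - 15 * ln L.
  move: s_le; rewrite -(ler_pM2l g0) => /le_trans; apply.
  rewrite le_eqVlt; apply/orP; left; apply/eqP; field; by rewrite gt_eqF.
have [k1 k2] : Num.min (1 - delta) (2 / 3) <= 1 - delta
    /\ Num.min (1 - delta) (2 / 3) <= 2 / 3 by rewrite !ge_min !lexx orbT.
have k1L := ler_wpM2r (ltW L0) k1; have k2L := ler_wpM2r (ltW L0) k2.
have dL : 0 <= delta * L by apply: mulr_ge0; [case/andP: delta01 => /ltW|exact: ltW].
pose W := gamma p ^+ s.
have WE : W = expR (g * S).
  by rewrite mulrC expRM_natl lnK ?posrE.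
have nE : n%:R = expR L :> R by rewrite lnK ?posrE.
have L15 : L ^+ 15 = expR (15 * ln L).
  by rewrite expRM_natl lnK ?posrE.
have ndE : n%:R `^ delta = expR (delta * L).
  by rewrite /powR gt_eqF.
have h1 : W * L ^+ 15 <= n%:R.
  by rewrite WE L15 nE -expRD ler_expR expRK; lra.
have h2 : W * (n%:R `^ delta) * L ^+ 15 <= n%:R.
  by rewrite ndE WE L15 -!expRD nE ler_expR expRK; lra.
have h3 : W ^+ 3 * L ^+ 15 <= n%:R ^+ 2.
  by rewrite WE L15 nE -!expRM_natl -!expRD ler_expR expRK; lra.
have hS : g * S <= L by lra.
have W0 : 0 < W by rewrite exprn_gt0.
have := total_error_le W n%:R (n%:R `^ delta) L C (gamma p) g S W0 nR
  (powR_ge0 _ _) L_ge1 C_gt0 gam0 g0 (ler0n _ _) h1 h2 h3 hS.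
have -> : W^-1 = (gamma p)^-1 ^+ s by rewrite exprVn.
have eta0 : 0 < (L ^+ 3)^-1 by rewrite invr_gt0 exprn_gt0.
have q0 : 0 < (gamma p)^-1 by rewrite invr_gt0.
have := copies_deviation_le p (gamma p)^-1 (C * n%:R `^ delta) (L ^+ 3)^-1 n s
  G H q0 (inv_gamma_le p p01) (inv_gamma_le1B p p01) n0 eta0 Gp.
rewrite /= -/S.
set X := S * (2 * _).
move: L_large; rewrite /rate => h Xdev Xle.
by apply: le_trans (Xdev _) _; lra.
Qed.

Lemma max_copies_deviation_log :
  max_copies_deviation p G
    (Num.min (1 - delta) (2 / 3) * (L / g) - 15 / g * ln L) <= rate / L.
Proof.
set b := (X in max_copies_deviation p G X).
have rate0 : 0 <= rate / L.
  by apply: divr_ge0; [exact: rate_ge0|exact: le_trans L_ge1].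
rewrite /max_copies_deviation big_nat_cond; apply: bigmax_le => // s /andP[/andP[s1 sb] _].
apply: bigmax_le => // H _; apply: copies_deviation_log.
have b0 : 0 <= b.
  by apply: le_trans ler01 _; rewrite -truncn_gt0; apply: leq_trans s1 sb.
by rewrite -(truncn_ge_nat _ b0).
Qed.
End Bound.

Local Open Scope classical_set_scope.

Theorem theorem1p4 (R : realType) (p : R) (hp : 0 < p < 1) :
  exists C5 : R, 0 < C5 /\
    forall (delta C : R) (G : forall n : nat, sgraph 'I_n),
      0 < delta < 1 -> 0 < C ->
      (forall (n : nat) (v : 'I_n),
          `| #|nbr (G n) v|%:R - n%:R * p | < C * n%:R `^ delta) ->
      (forall (n : nat) (v1 v2 : 'I_n), uniq [:: v1; v2] ->
          `| #|nbr (G n) v1 :&: nbr (G n) v2|%:R - n%:R * p ^+ 2 |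
            < C * n%:R `^ delta) ->
      (forall (n : nat) (v1 v2 v3 : 'I_n), uniq [:: v1; v2; v3] ->
          `| #|nbr (G n) v1 :&: nbr (G n) v2 :&: nbr (G n) v3|%:R
             - n%:R * p ^+ 3 | < C * n%:R `^ delta) ->
      (forall (n : nat) (v1 v2 v3 v4 : 'I_n), uniq [:: v1; v2; v3; v4] ->
          `| #|nbr (G n) v1 :&: nbr (G n) v2 :&: nbr (G n) v3
               :&: nbr (G n) v4|%:R
             - n%:R * p ^+ 4 | < C * n%:R `^ delta) ->
      (fun n : nat =>
         max_copies_deviation p (G n)
           (Num.min (1 - delta) (2 / 3) * (ln n%:R / ln (gamma p))
            - C5 * ln (ln n%:R)))
        @ \oo --> (0 : R).
Proof.
have g0 : 0 < ln (gamma p) by rewrite ln_gt0// gamma_gt1.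
exists (15 / ln (gamma p)); split; first by rewrite divr_gt0.
move=> delta C G d01 C0 H1 H2 H3 H4.
have Gp n : pseudorandom4 (G n) p (C * n%:R `^ delta).
  by split; rewrite card_ord => *; apply: ltW;
    [apply: H1|apply: H2|apply: H3|apply: H4].
pose K := rate p C.
apply/cvgr0Pnorm_le => e e0.
have lnP (A : R) : \forall n \near \oo, A <= ln (n%:R : R).
  near=> n.
  have An : expR A <= n%:R by near: n; exact: nbhs_infty_ger.
  by rewrite -[A]expRK ler_ln ?posrE ?expR_gt0// (lt_le_trans (expR_gt0 A)).
near=> n.
have L1 : 1 <= ln (n%:R : R) by near: n; exact: lnP.
have L2 : K / 2 <= ln (n%:R : R) by near: n; exact: lnP.
have Le : K / e <= ln (n%:R : R) by near: n; exact: lnP.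
have L0 : 0 < ln (n%:R : R) by apply: lt_le_trans L1.
have dev := max_copies_deviation_log p delta C n (G n) hp d01 C0 (Gp n) L1 _.
rewrite ger0_norm; last exact: bigmax_ge_id.
apply: le_trans (dev _) _; rewrite -/K.
  by rewrite ler_pdivrMr// mulrC -ler_pdivrMr.
by rewrite ler_pdivrMr// mulrC -ler_pdivrMr.
Unshelve. all: by end_near.
Qed.
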